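(* In general, the Adjusted Classify & Count approach is not Fisher consistent in $\mathcal{Q}_{\mathrm{invariant}}$: there exist a feature space $\mathcal{X}$, a training set distribution $\mathrm{P}^\ast$ of $(X,Y)$ on $\mathcal{X}\times\{0,1\}$ with $0<\mathrm{P}^\ast[Y=0]<1$ whose class-conditional feature distributions have densities, a classifier $g^\ast:\mathcal{X}\to\{0,1\}$ with $\mathrm{P}^\ast[g^\ast(X)=0\,|\,Y=0]\neq\mathrm{P}^\ast[g^\ast(X)=0\,|\,Y=1]$, and a distribution $\mathrm{Q}^\ast\in\mathcal{Q}_{\mathrm{invariant}}(\mathrm{P}^\ast)$ such that $$T_{g^\ast,\mathrm{P}^\ast}(\mathrm{Q}^\ast)\neq\mathrm{Q}^\ast[Y=0],$$ where $$T_{g,\mathrm{P}}(\mathrm{Q})=\frac{\mathrm{Q}[g(X)=0]-\mathrm{P}[g(X)=0\,|\,Y=1]}{\mathrm{P}[g(X)=0\,|\,Y=0]-\mathrm{P}[g(X)=0\,|\,Y=1]}.$$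
   Context: Setting: $(X,Y)$ is a random vector with values in $\mathcal{X}\times\{0,1\}$, where $\mathcal{X}$ is a measurable space; training distributions $\mathrm{P}$ and test distributions $\mathrm{Q}$ satisfy $0<\mathrm{P}[Y=0]<1$ and $0<\mathrm{Q}[Y=0]<1$. If $\mathrm{P}(X\,|\,Y=i)$ has density $f_i$, $i=0,1$, with respect to a reference measure $\mu$ on $\mathcal{X}$ (with $f_1>0$), then $\mathcal{Q}_{\mathrm{invariant}}(\mathrm{P})$ is the set of all such probability measures $\mathrm{Q}$ for which $\mathrm{Q}(X\,|\,Y=i)$ has a density $h_i$, $i=0,1$, with respect to $\mu$ (with $h_1>0$), and $\frac{f_0(x)}{f_1(x)}=\frac{h_0(x)}{h_1(x)}$ for all $x\in\mathcal{X}$. An estimator $T$ is Fisher consistent in a family $\mathcal{Q}$ of test set distributions for the prevalence of class 0 if $T(\mathrm{Q})=\mathrm{Q}[Y=0]$ for all $\mathrm{Q}\in\mathcal{Q}$. *)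

(* Defs.v *)
From HB Require Import structures.
From mathcomp Require Import all_boot all_order all_algebra.
From mathcomp Require Import all_classical all_reals all_analysis.
Set Implicit Arguments.
Unset Strict Implicit.
Unset Printing Implicit Defensive.
Import Order.TTheory GRing.Theory Num.Theory.

Local Open Scope classical_set_scope.
Local Open Scope ring_scope.

(* A distribution of (X, Y) is a probability on X * bool, with (X, Y) the
   coordinate maps. The label 0 is encoded by [false] and the label 1 by
   [true], both for Y and for the values of a classifier. *)

Definition cond_prob (d : measure_display) (T : measurableType d) (R : realType)
    (P : probability T R) (A B : set T) : R :=
  fine (P (A `&` B)) / fine (P B).

Definition label_event (X : Type) (i : bool) : set (X * bool) :=
  [set w | w.2 = i].

Definition feature_event (X : Type) (A : set X) : set (X * bool) :=
  [set w | A w.1].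

Definition predict0 (X : Type) (g : X -> bool) : set (X * bool) :=
  feature_event [set x | g x = false].

Definition prevalence0 (d : measure_display) (X : measurableType d)
    (R : realType) (P : probability (X * bool)%type R) : R :=
  fine (P (label_event false)).

Definition proper_prevalence (d : measure_display) (X : measurableType d)
    (R : realType) (P : probability (X * bool)%type R) : Prop :=
  0 < prevalence0 P < 1.

Definition is_class_density (d : measure_display) (X : measurableType d)
    (R : realType) (mu : {measure set X -> \bar R})
    (P : probability (X * bool)%type R) (i : bool) (f : X -> R) : Prop :=
  [/\ measurable_fun setT f,
      (forall x, 0 <= f x) &
      forall A : set X, measurable A ->
        (\int[mu]_(x in A) (f x)%:E =
         (cond_prob P (feature_event A) (label_event i))%:E)%E].

(* No sigma-finiteness is asked of mu: it follows from the existence of an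
   integrable density f1 that is positive everywhere. *)
Definition has_class_densities (d : measure_display) (X : measurableType d)
    (R : realType) (mu : {measure set X -> \bar R})
    (P : probability (X * bool)%type R) (f0 f1 : X -> R) : Prop :=
  [/\ is_class_density mu P false f0,
      is_class_density mu P true f1 &
      forall x, 0 < f1 x].

(* The family depends on the training distribution only through its
   class-conditional densities f0 and f1 with respect to mu. *)
Definition Qinvariant (d : measure_display) (X : measurableType d)
    (R : realType) (mu : {measure set X -> \bar R}) (f0 f1 : X -> R) :
    set (probability (X * bool)%type R) :=
  [set Q | proper_prevalence Q /\
     exists h0 h1 : X -> R, has_class_densities mu Q h0 h1 /\
       forall x, f0 x / f1 x = h0 x / h1 x].

Definition fisher_consistent (d : measure_display) (X : measurableType d)
    (R : realType) (family : set (probability (X * bool)%type R))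
    (T : probability (X * bool)%type R -> R) : Prop :=
  forall Q, family Q -> T Q = prevalence0 Q.

Definition adjusted_count (d : measure_display) (X : measurableType d)
    (R : realType) (g : X -> bool) (P Q : probability (X * bool)%type R) : R :=
  (fine (Q (predict0 g)) - cond_prob P (predict0 g) (label_event true)) /
  (cond_prob P (predict0 g) (label_event false)
   - cond_prob P (predict0 g) (label_event true)).

(* Main.v *)
Require Import Defs.
From HB Require Import structures.
From mathcomp Require Import all_boot all_order all_algebra.
From mathcomp Require Import all_classical all_reals all_analysis.
From mathcomp Require Import measurable_realfun lra.
Set Implicit Arguments.
Unset Strict Implicit.
Unset Printing Implicit Defensive.
Import Order.TTheory GRing.Theory Num.Theory.
Local Open Scope classical_set_scope.
Local Open Scope ring_scope.

(** Take three points whose density ratios [f0 / f1] are 3/2, 1 and 1/2. The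
    densities [h1 = (a, 1 - 2a, a)] and [h0 = (3a/2, 1 - 2a, a/2)] have these
    ratios for every [0 < a < 1/2], so the ratio does not determine the
    probability with which the classifier predicts 0 exactly at the first point.
    Train with [a = 1/3] and test with [a = 1/4], both with prevalence 1/2: the
    estimate is then -1/8. All distributions are empirical distributions of
    finite samples. *)

(** Splitting the sample into a head and a tail keeps it nonempty, so the total mass is 1. Rational
    weights come from repeated points. *)
Definition empirical (d : measure_display) (T : measurableType d)
    (R : realType) (x : T) (s : seq T) : set T -> \bar R :=
  mscale ((size s).+1%:R^-1)%:nng
    (msum (fun i => \d_(nth x (x :: s) i)) (size s).+1).

HB.instance Definition _ (d : measure_display) (T : measurableType d)
    (R : realType) (x : T) (s : seq T) :=
  Measure.on (@empirical d T R x s).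

Lemma empiricalE (d : measure_display) (T : measurableType d) (R : realType)
    (x : T) (s : seq T) (A : set T) :
  empirical R x s A =
    ((\sum_(y <- x :: s) (y \in A)%:R) / (size s).+1%:R)%:E.
Proof.
rewrite /empirical /mscale /msum (big_nth x) big_mkord mulrC EFinM -sumEFin.
by congr (_ * _)%E; apply: eq_bigr => i _; rewrite diracE.
Qed.

Lemma empirical_setT (d : measure_display) (T : measurableType d)
    (R : realType) (x : T) (s : seq T) :
  empirical R x s setT = 1%:E.
Proof.
rewrite empiricalE (eq_bigr (fun=> 1)) => [|y _]; last by rewrite in_setT.
by rewrite big_const_seq count_predT iter_addr_0 divff// pnatr_eq0.
Qed.

HB.instance Definition _ (d : measure_display) (T : measurableType d)
    (R : realType) (x : T) (s : seq T) :=
  Measure_isProbability.Build d T R (@empirical d T R x s)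
    (@empirical_setT d T R x s).

(** For a nonnegative integrand the integral is additive in the measure, and each Dirac term
    evaluates [f] at its atom. *)
Lemma integral_msum_dirac (d : measure_display) (T : measurableType d)
    (R : realType) (a : nat -> T) (n : nat) (f : T -> R) (A : set T) :
  measurable A -> measurable_fun setT f -> (forall x, 0 <= f x) ->
  (\int[msum (fun i => \d_(a i)) n]_(x in A) (f x)%:E =
   (\sum_(i < n) (a i \in A)%:R * f (a i))%:E)%E.
Proof.
move=> mA mf f0.
have mfA : measurable_fun A (EFin \o f).
  by apply: measurable_funTS; exact/measurable_EFinP.
rewrite ge0_integral_measure_sum// => [|x _]; last by rewrite lee_fin.
rewrite -sumEFin; apply: eq_bigr => i _.
by rewrite integral_dirac// diracE EFinM.
Qed.

(** In boolean form, the label test computes at a concrete sample point, leaving only the membership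
    in [A]. *)
Lemma mem_featureI_label (X : Type) (A : set X) (i : bool) (w : X * bool) :
  (w \in feature_event A `&` @label_event X i) = (w.1 \in A) && (w.2 == i).
Proof.
rewrite in_setI /feature_event /label_event.
apply/andP/andP => -[]; rewrite !inE => wA.
  by move=> /eqP.
by move=> /eqP.
Qed.

Lemma mem_label (X : Type) (i : bool) (w : X * bool) :
  (w \in @label_event X i) = (w.2 == i).
Proof. by apply/idP/eqP; rewrite inE. Qed.

Lemma mem_predict0 (X : Type) (g : X -> bool) (w : X * bool) :
  (w \in predict0 g) = ~~ g w.1.
Proof. by apply/idP/negPf; rewrite inE. Qed.

Lemma mem_setof_false (X : Type) (g : X -> bool) (x : X) :
  (x \in [set x | g x = false]) = ~~ g x.
Proof. by apply/idP/negPf; rewrite inE. Qed.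

Theorem mainTheorem4 (R : realType) :
  exists (d : measure_display) (X : measurableType d)
         (mu : {measure set X -> \bar R})
         (P : probability (X * bool)%type R) (f0 f1 : X -> R) (g : X -> bool),
    [/\ proper_prevalence P,
        has_class_densities mu P f0 f1,
        measurable_fun setT g,
        cond_prob P (predict0 g) (label_event false) <>
          cond_prob P (predict0 g) (label_event true) &
        ~ fisher_consistent (Qinvariant mu f0 f1) (adjusted_count g P) /\
        exists Q : probability (X * bool)%type R,
          Qinvariant mu f0 f1 Q /\ adjusted_count g P Q <> prevalence0 Q].
Proof.
(* Each sample also contains the head point [(0, false)] of [empirical]; the
   values of the densities beyond 2 are irrelevant, except that they must be
   positive with the same ratio. *)
pose sP : seq (nat * bool) := nseq 2 (0%N, false) ++ nseq 2 (1%N, false) ++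
  nseq 1 (2%N, false) ++
  nseq 2 (0%N, true) ++ nseq 2 (1%N, true) ++ nseq 2 (2%N, true).
pose sQ : seq (nat * bool) := nseq 2 (0%N, false) ++ nseq 4 (1%N, false) ++
  nseq 1 (2%N, false) ++
  nseq 2 (0%N, true) ++ nseq 4 (1%N, true) ++ nseq 2 (2%N, true).
pose P : probability (nat * bool)%type R := empirical R (0%N, false) sP.
pose Q : probability (nat * bool)%type R := empirical R (0%N, false) sQ.
pose mu : {measure set nat -> \bar R} := msum (fun i => \d_i) 3.
(* The default of [nth] is at once the value at 2 and the constant value beyond. *)
pose f0 (n : nat) : R := nth (1/6) [:: 1/2; 1/3] n.
pose f1 (n : nat) : R := 3^-1.
pose h0 (n : nat) : R := nth (1/8) [:: 3/8; 1/2] n.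
pose h1 (n : nat) : R := nth 4^-1 [:: 4^-1; 2^-1] n.
pose g (n : nat) := n != 0%N.
(* Head included, each label has 6 points under [P], with counts 3, 2, 1 for [false] and 2, 2, 2 for
   [true]; under [Q] it has 8, with counts 3, 4, 1 and 2, 4, 2. *)
have evP A : fine (P A) = (\sum_(y <- (0%N, false) :: sP) (y \in A)%:R) / 12.
  by rewrite /P/= empiricalE.
have evQ A : fine (Q A) = (\sum_(y <- (0%N, false) :: sQ) (y \in A)%:R) / 16.
  by rewrite /Q/= empiricalE.
(* Since [mu] has only the atoms 0, 1, 2, the density condition is a linear identity in three
   indicators, which [lra] settles for an arbitrary [A]. *)
have density (S : probability (nat * bool)%type R) (i : bool) (f : nat -> R) :
    (forall x, 0 <= f x) ->
    (forall A : set nat, (0%N \in A)%:R * f 0%N + (1%N \in A)%:R * f 1%N +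
       (2%N \in A)%:R * f 2%N =
       cond_prob S (feature_event A) (label_event i)) ->
    is_class_density mu S i f.
  move=> f_ge0 fE; split=> // A mA; rewrite integral_msum_dirac// -fE.
  by rewrite !big_ord_recr big_ord0/= add0r.
have labelP i : fine (P (label_event i)) = 2^-1.
  by rewrite evP !(big_cons, big_nil) !mem_label; case: i => /=; lra.
have labelQ i : fine (Q (label_event i)) = 2^-1.
  by rewrite evQ !(big_cons, big_nil) !mem_label; case: i => /=; lra.
have P0 : cond_prob P (predict0 g) (label_event false) = 1 / 2.
  rewrite /cond_prob labelP invrK evP !(big_cons, big_nil) !mem_featureI_label.
  rewrite !mem_setof_false/=; lra.
have P1 : cond_prob P (predict0 g) (label_event true) = 1 / 3.
  rewrite /cond_prob labelP invrK evP !(big_cons, big_nil) !mem_featureI_label.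
  rewrite !mem_setof_false/=; lra.
have Q0 : fine (Q (predict0 g)) = 5 / 16.
  rewrite evQ !(big_cons, big_nil) !mem_predict0/=; lra.
have invQ : Qinvariant mu f0 f1 Q.
  split; first by rewrite /proper_prevalence /prevalence0 labelQ; lra.
  exists h0, h1; split; last first.
    (* The ratios are 3/2, 1, 1/2, and 1/2 again at every point beyond 2. *)
    by case=> [|[|[|n]]]; rewrite /f0 /f1 /h0 /h1/= !invrK; lra.
  split.
  - apply: density => [[|[|[|n]]]|A]; rewrite /h0/=; [lra..|].
    rewrite /cond_prob labelQ invrK evQ !(big_cons, big_nil) !mem_featureI_label.
    rewrite /= !andbT !andbF/=; lra.
  - apply: density => [[|[|[|n]]]|A]; rewrite /h1/=; [lra..|].
    rewrite /cond_prob labelQ invrK evQ !(big_cons, big_nil) !mem_featureI_label.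
    rewrite /= !andbT !andbF/=; lra.
  - by case=> [|[|[|n]]]; rewrite /h1/=; lra.
have T_Q : adjusted_count g P Q <> prevalence0 Q.
  rewrite /adjusted_count P0 P1 Q0 /prevalence0 labelQ.
  (* With the denominator as a single inverse, the estimate becomes (5/16 - 1/3) * 6 = -1/8, against
     the prevalence 1/2. *)
  rewrite (_ : 1 / 2 - 1 / 3 = 6^-1) ?invrK; lra.
exists _, nat, mu, P, f0, f1, g; split.
- by rewrite /proper_prevalence /prevalence0 labelP; lra.
- split.
  + apply: density => [[|[|[|n]]]|A]; rewrite /f0/=; [lra..|].
    rewrite /cond_prob labelP invrK evP !(big_cons, big_nil) !mem_featureI_label.
    rewrite /= !andbT !andbF/=; lra.
  + apply: density => [n|A]; rewrite /f1; first lra.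
    rewrite /cond_prob labelP invrK evP !(big_cons, big_nil) !mem_featureI_label.
    rewrite /= !andbT !andbF/=; lra.
  + by move=> n; rewrite /f1; lra.
(* Every subset of [nat] is measurable. *)
- by [].
- rewrite P0 P1; lra.
- by split; [move=> /(_ Q invQ)|exists Q].
Qed.
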